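(* Let $A$ be a commutative Noetherian ring. The assignment $$[I]\longmapsto \operatorname{MaxAss}_A(A/I)$$ gives a (well-defined) bijection between the denominator-equivalence classes of proper ideals of $A$ and the finite non-empty antichains in $\operatorname{Spec}(A)$.
   Context: For an ideal $I$ of $A$, the regular-denominator set of $I$ is $S_I:=\{a\in A\mid \text{multiplication by } a \text{ on } A/I \text{ is injective}\}=\{a\in A\mid (I:a)=I\}$. Two ideals $I$ and $J$ of $A$ are denominator equivalent, written $I\sim J$, if $S_I=S_J$; this is an equivalence relation on the set of proper ideals of $A$, and $[I]$ denotes the class of $I$. $\operatorname{Ass}_A(M)$ is the set of associated primes of an $A$-module $M$, and $\operatorname{MaxAss}_A(A/I)$ is the set of elements of $\operatorname{Ass}_A(A/I)$ that are maximal with respect to inclusion among the elements of $\operatorname{Ass}_A(A/I)$. An antichain in $\operatorname{Spec}(A)$ is a set of prime ideals no two distinct members of which are comparable under inclusion. *)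

(* Defs.v *)
From HB Require Import structures.
From mathcomp Require Import all_boot all_algebra.
From mathcomp Require Import boolp classical_sets functions cardinality.

Set Implicit Arguments.
Unset Strict Implicit.
Unset Printing Implicit Defensive.

Import GRing.Theory.

Local Open Scope classical_set_scope.
Local Open Scope quotient_scope.
Local Open Scope ring_scope.

(* The structure [idealr] of ring_quotient is not used: it only exists over
   nonzero rings, whereas the zero ring (which has no proper ideal and no prime
   ideal) is allowed here.  The whole ring is an [ideal]. *)
Record ideal (A : comPzRingType) := Ideal {
  ideal_set :> set A;
  ideal_has0 : ideal_set 0;
  ideal_hasD : forall x y, ideal_set x -> ideal_set y -> ideal_set (x + y);
  ideal_hasM : forall a x, ideal_set x -> ideal_set (a * x)
}.

Lemma ideal_eq (A : comPzRingType) (I J : ideal A) :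
  (I : set A) = J -> I = J.
Proof.
case: I J => [I I0 ID IM] [J J0 JD JM] /= eIJ; subst J.
by rewrite (Prop_irrelevance I0 J0) (Prop_irrelevance ID JD)
  (Prop_irrelevance IM JM).
Qed.

Definition proper_ideals (A : comPzRingType) : set (ideal A) :=
  [set I : ideal A | ~ ideal_set I 1].

Definition Spec (A : comPzRingType) : set (ideal A) :=
  [set P : ideal A |
    ~ ideal_set P 1 /\
    forall x y, ideal_set P (x * y) -> ideal_set P x \/ ideal_set P y].

Definition noetherian (A : comPzRingType) : Prop :=
  forall I : ideal A, exists (n : nat) (g : 'I_n -> A),
    (I : set A) = [set x | exists c : 'I_n -> A, x = \sum_(i < n) c i * g i].

Section Annihilator.
Variables (A : comPzRingType) (M : lmodType A) (m : M).

Let ann_set : set A := [set a | a *: m = 0].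

Let ann0 : ann_set 0. Proof. exact: scale0r. Qed.

Let annD x y : ann_set x -> ann_set y -> ann_set (x + y).
Proof. by rewrite /ann_set /= scalerDl => -> ->; rewrite addr0. Qed.

Let annM a x : ann_set x -> ann_set (a * x).
Proof. by rewrite /ann_set /= -scalerA => ->; rewrite scaler0. Qed.

Definition ann : ideal A := Ideal ann0 annD annM.

End Annihilator.

Definition Ass (A : comPzRingType) (M : lmodType A) : set (ideal A) :=
  [set P | Spec P /\ exists m : M, P = ann m].

Definition MaxAss (A : comPzRingType) (M : lmodType A) : set (ideal A) :=
  [set P | Ass M P /\
    forall Q : ideal A, Ass M Q -> (P : set A) `<=` Q -> Q = P].

(* The A-module A/I: the additive group is the library's quotient of a zmodType
   by an additive subgroup, on which scalars act by a *: \pi x = \pi (a * x). *)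
Section QuotientModule.
Variables (A : comPzRingType) (I : ideal A).

Definition ideal_pred : A -> bool := fun x => `[< ideal_set I x >].

Lemma ideal_pred_zmod_closed : zmod_closed ideal_pred.
Proof.
split=> [|x y /asboolP Ix /asboolP Iy]; apply/asboolP; first exact: ideal_has0.
by rewrite -mulN1r; apply: ideal_hasD => //; apply: ideal_hasM.
Qed.

HB.instance Definition _ :=
  GRing.isZmodClosed.Build A ideal_pred ideal_pred_zmod_closed.

Definition ideal_zmodClosed : zmodClosed A :=
  GRing.ZmodClosed.clone A ideal_pred _.

Definition quotient_module : Type := Quotient.quot ideal_zmodClosed.

HB.instance Definition _ := GRing.Zmodule.on quotient_module.

Definition quotient_pi (x : A) : quotient_module :=
  \pi_(Quotient.quot ideal_zmodClosed) x.

Definition quotient_scale (a : A) (u : quotient_module) : quotient_module :=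
  quotient_pi (a * repr (u : Quotient.quot ideal_zmodClosed)).

Lemma quotient_piE x y : quotient_pi x = quotient_pi y <-> ideal_set I (x - y).
Proof.
rewrite /quotient_pi; split=> [/eqP|Ixy]; first by
  rewrite -Quotient.idealrBE => /asboolP.
by apply/eqP; rewrite -Quotient.idealrBE; apply/asboolP.
Qed.

Lemma quotient_piD x y : quotient_pi (x + y) = quotient_pi x + quotient_pi y.
Proof. exact: (raddfD (\pi_(Quotient.quot ideal_zmodClosed))). Qed.

Lemma quotient_piP u : exists x, u = quotient_pi x.
Proof. by exists (repr (u : Quotient.quot ideal_zmodClosed)); rewrite /quotient_pi reprK. Qed.

Lemma quotient_scaleE a x : quotient_scale a (quotient_pi x) = quotient_pi (a * x).
Proof.
apply/quotient_piE; rewrite -mulrBr; apply: ideal_hasM; apply/quotient_piE.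
by rewrite /quotient_pi reprK.
Qed.

Lemma quotient_scaleA a b u :
  quotient_scale a (quotient_scale b u) = quotient_scale (a * b) u.
Proof. by have [x ->] := quotient_piP u; rewrite !quotient_scaleE mulrA. Qed.

Lemma quotient_scale1 : left_id 1 quotient_scale.
Proof. by move=> u; have [x ->] := quotient_piP u; rewrite quotient_scaleE mul1r. Qed.

Lemma quotient_scaleDr : right_distributive quotient_scale +%R.
Proof.
move=> a u v; have [x ->] := quotient_piP u; have [y ->] := quotient_piP v.
by rewrite -quotient_piD !quotient_scaleE mulrDr quotient_piD.
Qed.

Lemma quotient_scaleDl u : {morph quotient_scale^~ u : a b / a + b}.
Proof.
by move=> a b; have [x ->] := quotient_piP u;
   rewrite !quotient_scaleE mulrDl quotient_piD.
Qed.

HB.instance Definition _ := GRing.Zmodule_isLmodule.Build A quotient_module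
  quotient_scaleA quotient_scale1 quotient_scaleDr quotient_scaleDl.

End QuotientModule.

Definition regular_denominators (A : comPzRingType) (I : ideal A) : set A :=
  [set a | injective (fun u : quotient_module I => a *: u)].

Definition denominator_equiv (A : comPzRingType) (I J : ideal A) : Prop :=
  regular_denominators I = regular_denominators J.

Definition denominator_class (A : comPzRingType) (I : ideal A) : set (ideal A) :=
  [set J | proper_ideals J /\ denominator_equiv I J].

Definition denominator_classes (A : comPzRingType) : set (set (ideal A)) :=
  [set denominator_class I | I in @proper_ideals A].

Definition antichain (A : comPzRingType) (F : set (ideal A)) : Prop :=
  F `<=` @Spec A /\
  forall P Q : ideal A, F P -> F Q -> (P : set A) `<=` Q -> P = Q.

Definition finite_nonempty_antichains (A : comPzRingType) :
    set (set (ideal A)) :=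
  [set F | [/\ antichain F, finite_set F & F !=set0]].

(* Main.v *)
Require Import Defs.
From mathcomp Require Import all_boot all_algebra.
From mathcomp Require Import boolp classical_sets functions cardinality.
From HB Require Import structures.

(* The complement of S_I is the union of the associated primes of A/I, hence,
   A being Noetherian, the union of MaxAss(A/I).  Conversely MaxAss(A/I) is
   recovered from this union by prime avoidance, since it is a finite antichain.
   Finally, a finite antichain F of primes is MaxAss(A/I) for I the intersection
   of F: the colon ideals (I : x) are the intersections of subfamilies of F. *)

Set Implicit Arguments.
Unset Strict Implicit.
Unset Printing Implicit Defensive.

Import GRing.Theory.

Local Open Scope classical_set_scope.
Local Open Scope ring_scope.

(** Classical decidable equality on ideals, so that a finite set of ideals can be listed as a
    sequence and tested with [\in]. *)
HB.instance Definition _ (A : comPzRingType) := gen_eqMixin (ideal A).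

Section Ideals.
Variable A : comPzRingType.
Implicit Types (I J P Q : ideal A) (F : set (ideal A)) (a b x y : A).

Lemma ideal_sub_anti I J :
  (I : set A) `<=` J -> (J : set A) `<=` I -> I = J.
Proof. by move=> IJ JI; apply/ideal_eq/seteqP. Qed.

Lemma ideal_hasMr I a x : ideal_set I x -> ideal_set I (x * a).
Proof. by rewrite mulrC; apply: ideal_hasM. Qed.

Lemma ideal_hasB I x y :
  ideal_set I x -> ideal_set I y -> ideal_set I (x - y).
Proof. by move=> Ix Iy; rewrite -mulN1r; apply/ideal_hasD/ideal_hasM. Qed.

(** * Unions of chains of ideals and maximal elements *)

Section ChainUnion.
Variables (F : set (ideal A)) (I0 : ideal A).
Hypotheses (FI0 : F I0)
  (Ftot : forall I J, F I -> F J -> (I : set A) `<=` J \/ (J : set A) `<=` I).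

Let U : set A := \bigcup_(I in F) I.

Let U0 : U 0. Proof. by exists I0 => //; apply: ideal_has0. Qed.

Let UD x y : U x -> U y -> U (x + y).
Proof.
move=> [I FI Ix] [J FJ Jy]; have [IJ|JI] := Ftot FI FJ.
  by exists J => //; apply: ideal_hasD => //; apply: IJ.
by exists I => //; apply: ideal_hasD => //; apply: JI.
Qed.

Let UM a x : U x -> U (a * x).
Proof. by move=> [I FI Ix]; exists I => //; apply: ideal_hasM. Qed.

Lemma chain_union : exists J, (J : set A) = \bigcup_(I in F) I.
Proof. by exists (Ideal U0 UD UM). Qed.

Lemma chain_family n (g : 'I_n -> A) :
  (forall i, (\bigcup_(I in F) (I : set A)) (g i)) ->
  exists2 J, F J & forall i, ideal_set J (g i).
Proof.
elim: n g => [|n IHn] g Ug; first by exists I0 => // -[].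
have [J FJ Jg] := IHn (fun i => g (lift ord0 i)) (fun i => Ug _).
have [I FI Ig] := Ug ord0.
have [IJ|JI] := Ftot FI FJ.
  exists J => // i; case: (unliftP ord0 i) => [j|] -> //; exact: IJ.
exists I => // i; case: (unliftP ord0 i) => [j|] -> //; exact/JI/Jg.
Qed.

End ChainUnion.

(** Zorn's lemma applies: the union of a nonempty chain is an ideal with finitely many generators;
    these already lie in one member of the chain, which is therefore an upper bound. *)
Lemma noetherian_maximal F : noetherian A -> F !=set0 ->
  exists2 I, F I & forall J, F J -> (I : set A) `<=` J -> J = I.
Proof.
move=> noethA [I0 FI0].
pose T := {I | F I}.
pose R (s t : T) := `[< (sval s : set A) `<=` sval t >].
have [t|r s t|C Ctot|[I FI] maxI] := @ZL_preorder T (exist _ I0 FI0) R.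
- exact/asboolP.
- by move=> /asboolP rs /asboolP st; apply/asboolP => x /rs/st.
- have [-> | /set0P[t0 Ct0]] := eqVneq C set0; first by exists (exist _ I0 FI0).
  pose G := [set sval t | t in C].
  have GI0 : G (sval t0) by exists t0.
  have Gtot I J : G I -> G J -> (I : set A) `<=` J \/ (J : set A) `<=` I.
    move=> [s Cs <-] [t Ct <-].
    by have [/asboolP|/asboolP] := Ctot _ _ Cs Ct; [left|right].
  have [U UE] := chain_union GI0 Gtot.
  have [n [g Ug]] := noethA U.
  have [|_ [t Ct <-] tg] := chain_family (g := g) GI0 Gtot.
    (* Kronecker delta coefficients show that the generator [g i] lies in [U]. *)
    move=> i; rewrite -UE Ug; exists (fun j => (j == i)%:R).
    rewrite (bigD1 i)//= eqxx mul1r big1 ?addr0// => j /negPf->.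
    by rewrite mul0r.
  exists t => s Cs; apply/asboolP => x sx.
  have : (U : set A) x by rewrite UE; exists (sval s) => //; exists s.
  rewrite Ug => -[c ->]; elim/big_ind : _ => [|y z|i _].
  + exact: ideal_has0.
  + exact: ideal_hasD.
  + exact: ideal_hasM.
exists I => // J FJ IJ; apply: ideal_sub_anti => //.
by apply/asboolP/(maxI (exist _ J FJ)); apply/asboolP.
Qed.

(** * Prime avoidance *)

Lemma prime_separation P (s : seq (ideal A)) : Spec P ->
  (forall Q, Q \in s -> ~ (Q : set A) `<=` P) ->
  exists2 y, (forall Q, Q \in s -> ideal_set Q y) & ~ ideal_set P y.
Proof.
move=> [P1 PM]; elim: s => [|Q s IHs] sP; first by exists 1.
have [|y sy Py] := IHs; first by move=> Q' Q's; apply: sP; rewrite inE Q's orbT.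
have [z [Qz Pz]] : exists z, ideal_set Q z /\ ~ ideal_set P z.
  apply: contrapT => noz; apply: (sP Q); rewrite ?mem_head// => z Qz.
  by apply: contrapT => Pz; apply: noz; exists z.
(* The product lies in [Q] and in every member of [s], and stays outside [P] by primality. *)
exists (y * z) => [Q'|/PM[]//]; rewrite inE => /orP[/eqP->|/sy].
  exact: ideal_hasM.
exact: ideal_hasMr.
Qed.

Lemma antichain_avoidance F I : antichain F -> finite_set F ->
  (I : set A) `<=` \bigcup_(P in F) P -> exists2 P, F P & (I : set A) `<=` P.
Proof.
move=> [Fprime Fanti] /finite_seqP[s sF] IF; apply: contrapT => noP.
have {}noP P : F P -> ~ (I : set A) `<=` P by move=> FP IP; apply: noP; exists P.
suff [x Ix xF] : exists2 x, ideal_set I x & forall P, P \in s -> ~ ideal_set P x.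
  by have [P + Px] := IF _ Ix; rewrite sF => /xF /(_ Px).
have : {subset s <= [pred P | `[< F P >]]}.
  by move=> P Ps; apply/asboolP; rewrite sF.
elim: s {sF} => [_|P s IHs sF]; first by exists 0 => //; apply: ideal_has0.
have FP : F P by apply/asboolP/sF/mem_head.
have {}sF Q : Q \in s -> F Q.
  by move=> Qs; apply/asboolP/sF; rewrite inE Qs orbT.
have [|x Ix xs] := IHs; first by move=> Q /sF FQ; apply/asboolP.
have [Ps|Ps] := boolP (P \in s).
  by exists x => // Q; rewrite inE => /orP[/eqP->|]; apply: xs.
have [Px|Px] := pselect (ideal_set P x); last first.
  by exists x => // Q; rewrite inE => /orP[/eqP->|/xs].
(* Here [x] avoids [s] but lies in [P]. By the antichain condition no prime of [s] lies in [P], nor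
   does [I], so some [y] in [I] and in all of [s] is outside [P]; adding it moves [x] out of [P] and
   keeps it outside [s]. *)
have [|y ys Py] := @prime_separation P (I :: s) (Fprime _ FP).
  move=> Q; rewrite inE => /orP[/eqP->|Qs]; first exact: noP.
  by move=> QP; move: Ps; rewrite -(Fanti _ _ (sF _ Qs) FP QP) Qs.
exists (x + y) => [|Q].
  by apply: ideal_hasD => //; apply: ys; apply: mem_head.
rewrite inE => /orP[/eqP-> Pxy|Qs Qxy].
  by apply: Py; rewrite -(addKr x y) addrC; apply: ideal_hasB.
apply: (xs Q Qs); rewrite -(addrK y x); apply: ideal_hasB => //.
by apply: ys; rewrite inE Qs orbT.
Qed.

(** * Associated primes and regular denominators in terms of colon ideals *)

Definition colon I x : ideal A := ann (quotient_pi I x).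

Lemma colonE I x a : ideal_set (colon I x) a <-> ideal_set I (a * x).
Proof.
have pi0 : quotient_pi I 0 = 0.
  by apply: (addIr (quotient_pi I 0)); rewrite -quotient_piD !add0r.
rewrite -[X in ideal_set I X]subr0 -quotient_piE pi0.
by rewrite -quotient_scaleE.
Qed.

Lemma AssE I P :
  Ass (quotient_module I) P <-> Spec P /\ exists x, P = colon I x.
Proof.
split=> -[primeP [m PE]]; split=> //; last by exists (quotient_pi I m).
by have [x mE] := quotient_piP m; exists x; rewrite PE mE.
Qed.

Lemma regular_denominatorsE I a :
  regular_denominators I a <-> forall x, ideal_set I (a * x) -> ideal_set I x.
Proof.
split=> [inj x Iax|reg u v].
  rewrite -[x]subr0; apply/quotient_piE/inj; rewrite /= /GRing.scale/=.
  by rewrite !quotient_scaleE; apply/quotient_piE; rewrite mulr0 subr0.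
have [x ->] := quotient_piP u; have [y ->] := quotient_piP v.
rewrite /= /GRing.scale/= !quotient_scaleE => /quotient_piE.
by rewrite -mulrBr => /reg/quotient_piE.
Qed.

Lemma colon_Spec_neq I x : Spec (colon I x) -> ~ ideal_set I x.
Proof. by move=> [+ _] Ix; apply; apply/colonE; rewrite mul1r. Qed.

(** * Associated primes when I is enlarged to I + Ax *)

Section PrincipalExtension.
Variables (I : ideal A) (x : A).

Let E : set A := [set z | exists a, ideal_set I (z - a * x)].

Let E0 : E 0.
Proof. by exists 0; rewrite mul0r subr0; apply: ideal_has0. Qed.

Let ED y z : E y -> E z -> E (y + z).
Proof.
move=> [a Ia] [b Ib]; exists (a + b).
by rewrite mulrDl opprD addrACA; apply: ideal_hasD.
Qed.

Let EM c y : E y -> E (c * y).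
Proof.
by move=> [a Ia]; exists (c * a); rewrite -mulrA -mulrBr; apply: ideal_hasM.
Qed.

Definition add_principal : ideal A := Ideal E0 ED EM.

End PrincipalExtension.

(* If (I : y) is a prime Q and no multiple of y by an element outside Q lies in
   I + Ax, then (I + Ax : y) = Q; otherwise Q = (I : a y) = (P : b) where
   P = (I : x), whence Q = P. *)
Lemma Ass_add_principal I x : Spec (colon I x) ->
  Ass (quotient_module I) `<=`
  colon I x |` Ass (quotient_module (add_principal I x)).
Proof.
move=> [_ primeP] Q /AssE[primeQ [y QE]].
have [[a [Qa [b Iab]]]|noa] := pselect (exists a,
    ~ ideal_set Q a /\ ideal_set (add_principal I x) (a * y)).
  left; have QEab c : ideal_set Q c <-> ideal_set I (c * (b * x)).
    have -> : ideal_set I (c * (b * x)) <-> ideal_set I (c * (a * y)).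
      have Iabc := ideal_hasM c Iab; rewrite mulrBr in Iabc.
      split=> Ic; last by rewrite -[_ * _](subKr (c * (a * y))); apply: ideal_hasB.
      by rewrite -[_ * _](subrK (c * (b * x))); apply: ideal_hasD.
    (* (I : a y) = (Q : a) = Q, since [Q] is prime and [a] lies outside it. *)
    rewrite mulrA -colonE -QE; split=> [|/(primeQ.2)[]//]; exact: ideal_hasMr.
  have Pb : ~ ideal_set (colon I x) b.
    by move=> /colonE Ibx; apply: primeQ.1; apply/QEab; rewrite mul1r.
  apply: ideal_sub_anti => c.
    by move=> /QEab; rewrite mulrA -colonE => /primeP[].
  by move=> /colonE Icx; apply/QEab; rewrite mulrCA; apply: ideal_hasM.
right; apply/AssE; split=> //; exists y; apply: ideal_sub_anti => a.
  rewrite {1}QE => /colonE Iay; apply/colonE; exists 0.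
  by rewrite mul0r subr0.
by move=> /colonE Iay; apply: contrapT => Qa; apply: noa; exists a.
Qed.

(** * Associated primes over a Noetherian ring *)

Hypothesis noethA : noetherian A.

(** A maximal (I : y) among the proper colon ideals above (I : x) is prime: if a b y is in I but b y
    is not, then (I : b y) contains (I : y), hence equals it, and it contains a. *)
Lemma colon_sub_Ass I x : ~ ideal_set I x ->
  exists2 P, Ass (quotient_module I) P & (colon I x : set A) `<=` P.
Proof.
move=> Ix.
pose F := [set Q | exists y, [/\ ~ ideal_set I y, Q = colon I y
  & (colon I x : set A) `<=` Q]].
have [|_ [y [Iy -> xy]] ymax] := @noetherian_maximal F noethA.
  by exists (colon I x); exists x; split.
exists (colon I y) => //; apply/AssE; split; last by exists y.
split=> [/colonE|a b /colonE Iaby]; first by rewrite mul1r.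
have [Iby|Iby] := pselect (ideal_set I (b * y)); first by right; apply/colonE.
left; have yby : (colon I y : set A) `<=` colon I (b * y).
  by move=> c /colonE Icy; apply/colonE; rewrite mulrCA; apply: ideal_hasM.
rewrite -(ymax (colon I (b * y))) //; first by apply/colonE; rewrite mulrA.
by exists (b * y); split=> // c /xy/yby.
Qed.

Lemma Ass_sub_MaxAss I P : Ass (quotient_module I) P ->
  exists2 Q, MaxAss (quotient_module I) Q & (P : set A) `<=` Q.
Proof.
move=> assP.
have [|Q [assQ PQ] Qmax] := @noetherian_maximal
    [set Q | Ass (quotient_module I) Q /\ (P : set A) `<=` Q] noethA.
  by exists P; split.
exists Q => //; split=> // Q' assQ' QQ'; apply: Qmax => //.
by split=> // c /PQ/QQ'.
Qed.

Lemma zero_divisors_MaxAss I :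
  ~` regular_denominators I = \bigcup_(P in MaxAss (quotient_module I)) P.
Proof.
apply/seteqP; split=> a.
  move=> /regular_denominatorsE/existsNP[x /not_implyP[Iax Ix]].
  have [P /Ass_sub_MaxAss[Q maxQ PQ] xP] := colon_sub_Ass Ix.
  by exists Q => //; apply/PQ/xP/colonE.
move=> [P [/AssE[primeP [x PE]] _] Pa] /regular_denominatorsE reg.
rewrite PE in primeP Pa; apply: (colon_Spec_neq primeP).
by apply: reg; apply/colonE.
Qed.

(** Noetherian induction: take J maximal among the counterexamples and an associated prime P = (J :
    x). Then J + Ax is strictly larger, so has finitely many associated primes, and those of J are
    among them and P. *)
Lemma finite_Ass I : finite_set (Ass (quotient_module I)).
Proof.
apply: contrapT => infI.
have [|{infI}J infJ Jmax] := @noetherian_maximal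
  [set I | ~ finite_set (Ass (quotient_module I))] noethA; first by exists I.
apply: infJ; have [->|/set0P[P assP]] := eqVneq (Ass (quotient_module J)) set0.
  exact: finite_set0.
have /AssE[+ [x PE]] := assP; rewrite PE => primeP.
apply: sub_finite_set (Ass_add_principal primeP) _.
rewrite finite_setU; split; first exact: finite_set1.
(* If J + Ax were equal to J, then x would lie in J and (J : x) would not be proper. *)
apply: contrapT => /Jmax JE; apply: (colon_Spec_neq primeP).
rewrite -JE; first by exists 1; rewrite mul1r subrr; apply: ideal_has0.
by move=> y Jy; exists 0; rewrite mul0r subr0.
Qed.

Lemma MaxAss_finite_nonempty_antichain I : proper_ideals I ->
  finite_nonempty_antichains (MaxAss (quotient_module I)).
Proof.
move=> I1; split.
- split=> [P [[]]//|P Q [assP Pmax] [assQ _] PQ].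
  by rewrite (Pmax Q).
- by apply: sub_finite_set (finite_Ass I) => P [].
(* As 1 is not in I, the colon ideal (I : 1) lies in an associated prime. *)
- by have [P /Ass_sub_MaxAss[Q maxQ _] _] := colon_sub_Ass I1; exists Q.
Qed.

(** By avoidance, P in F lies in some Q in G, which lies in some P' in F; the antichain condition
    gives P = P', so P = Q. *)
Lemma antichain_bigcup_inj F G :
  antichain F -> finite_set F -> antichain G -> finite_set G ->
  \bigcup_(P in F) (P : set A) = \bigcup_(P in G) (P : set A) -> F = G.
Proof.
suff sub F' G' : antichain F' -> finite_set F' -> antichain G' ->
    finite_set G' ->
    \bigcup_(P in F') (P : set A) = \bigcup_(P in G') (P : set A) ->
    F' `<=` G'.
  by move=> ? ? ? ? FG; apply/seteqP; split; apply: sub.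
move=> antiF finF antiG finG FG P FP.
have [|Q GQ PQ] := @antichain_avoidance G' P antiG finG.
  by rewrite -FG => x Px; exists P.
have [|P' FP' QP'] := @antichain_avoidance F' Q antiF finF.
  by rewrite FG => x Qx; exists Q.
have PP' : P = P' by apply: antiF.2 => // x /PQ/QP'.
by rewrite (ideal_sub_anti PQ) // PP'.
Qed.

Lemma denominator_equivE I J : proper_ideals I -> proper_ideals J ->
  denominator_equiv I J <->
  MaxAss (quotient_module I) = MaxAss (quotient_module J).
Proof.
move=> I1 J1; split=> [IJ|IJ]; last first.
  by apply: setC_inj; rewrite !zero_divisors_MaxAss IJ.
have [antiI finI _] := MaxAss_finite_nonempty_antichain I1.
have [antiJ finJ _] := MaxAss_finite_nonempty_antichain J1.
by apply: antichain_bigcup_inj => //; rewrite -!zero_divisors_MaxAss IJ.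
Qed.

(** * Realizing an antichain by the intersection of its members *)

Section Intersection.
Variable F : set (ideal A).

Let C : set A := \bigcap_(P in F) P.

Let C0 : C 0. Proof. by move=> P _; apply: ideal_has0. Qed.

Let CD x y : C x -> C y -> C (x + y).
Proof. by move=> Cx Cy P FP; apply: ideal_hasD; [apply: Cx|apply: Cy]. Qed.

Let CM a x : C x -> C (a * x).
Proof. by move=> Cx P FP; apply/ideal_hasM/Cx. Qed.

Definition bigcap_ideal : ideal A := Ideal C0 CD CM.

End Intersection.

Lemma Ass_bigcap_ideal F : antichain F -> finite_set F ->
  Ass (quotient_module (bigcap_ideal F)) = F.
Proof.
move=> [Fprime Fanti] /finite_seqP[s sF].
apply/seteqP; split=> P.
  move=> /AssE[primeP [x PE]].
  (* [P] = (I : x) lies in each member of [F] that misses [x]; equality follows once one such member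
     lies in [P]. *)
  have sub Q : F Q -> ~ ideal_set Q x -> (P : set A) `<=` Q.
    move=> FQ Qx c; rewrite PE => /colonE /(_ Q FQ).
    by case/(Fprime Q FQ).2.
  have [[Q [FQ Qx QP]]|noQ] :=
      pselect (exists Q, [/\ F Q, ~ ideal_set Q x & (Q : set A) `<=` P]).
    by rewrite (ideal_sub_anti (sub Q FQ Qx) QP).
  (* Otherwise some [y] outside [P] lies in every member of [F] missing [x]; then y x is in the
     intersection, so [y] is in [P] after all. *)
  have [|y ys []] := @prime_separation P [seq Q <- s | `[< ~ ideal_set Q x >]]
    primeP.
    move=> Q; rewrite mem_filter => /andP[/asboolP Qx Qs] QP; apply: noQ.
    by exists Q; split=> //; rewrite sF.
  rewrite PE; apply/colonE; rewrite /= => Q FQ.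
  have [Qx|Qx] := pselect (ideal_set Q x); first exact: ideal_hasM.
  apply/ideal_hasMr/ys; rewrite mem_filter; apply/andP; split.
    exact/asboolP.
  by move: FQ; rewrite sF.
move=> FP; apply/AssE; split; first exact: Fprime.
(* An [x] outside [P] but in all other members of [F] has colon ideal exactly [P]. *)
have [|x xs Px] := @prime_separation P [seq Q <- s | Q != P] (Fprime _ FP).
  move=> Q; rewrite mem_filter => /andP[/eqP QP Qs] subQP; apply: QP.
  by apply: Fanti => //; rewrite sF.
exists x; apply: ideal_sub_anti => c.
  move=> Pc; apply/colonE; rewrite /= => Q FQ.
  have [->|QP] := eqVneq Q P; first exact: ideal_hasMr.
  by apply/ideal_hasM/xs; rewrite mem_filter QP; move: FQ; rewrite sF.
by move=> /colonE /(_ P FP) /(Fprime P FP).2[].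
Qed.

Lemma MaxAss_bigcap_ideal F : antichain F -> finite_set F ->
  MaxAss (quotient_module (bigcap_ideal F)) = F.
Proof.
move=> antiF finF; have AssF := Ass_bigcap_ideal antiF finF.
apply/seteqP; split=> P; rewrite /MaxAss /= AssF; first by case.
by move=> FP; split=> // Q FQ /(antiF.2 _ _ FP FQ).
Qed.

End Ideals.

Theorem proposition3p3 (A : comPzRingType) (noethA : noetherian A) :
  exists f : set (ideal A) -> set (ideal A),
    (forall I : ideal A, proper_ideals I ->
       f (denominator_class I) = MaxAss (quotient_module I)) /\
    set_bij (@denominator_classes A) (@finite_nonempty_antichains A) f.
Proof.
(* The union avoids choosing a representative: all members of a class contribute the same set. *)
pose f (C : set (ideal A)) := \bigcup_(I in C) MaxAss (quotient_module I).
have fE I : proper_ideals I ->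
    f (denominator_class I) = MaxAss (quotient_module I).
  move=> I1; apply/seteqP; split=> [P [J [J1 IJ]]|P maxP]; last by exists I.
  by rewrite ((denominator_equivE noethA I1 J1).1 IJ).
exists f; split=> //; split.
- move=> _ [I I1 <-]; rewrite fE //.
  exact: MaxAss_finite_nonempty_antichain.
- move=> _ _ /set_mem[I I1 <-] /set_mem[J J1 <-]; rewrite !fE // => eqIJ.
  have IJ := (denominator_equivE noethA I1 J1).2 eqIJ.
  by apply/seteqP; split=> K [K1 KE]; split=> //; rewrite /denominator_equiv
    -?KE ?IJ // -?IJ.
- move=> F [antiF finF [P FP]].
  (* Nonemptiness of [F] matters here: the intersection lies in the prime [P], which omits 1. *)
  have I1 : proper_ideals (bigcap_ideal F).
    by move=> /(_ P FP); apply: (antiF.1 P FP).1.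
  exists (denominator_class (bigcap_ideal F)); first by exists (bigcap_ideal F).
  by rewrite fE // MaxAss_bigcap_ideal.
Qed.
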